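(* Let $(X_1,\mu_1),\ldots,(X_n,\mu_n)$ be $\sigma$-finite measure spaces with product $(X,\mu)$. Let $p_1,\ldots,p_n\in(0,\infty]$ and let $$P=\left(\begin{array}{ccc}p_1&\cdots&p_n\\ x_1&\cdots&x_n\end{array}\right).$$ Let $m$ be the number of elements of the orbit $\{P^\sigma:\sigma\in S_n\}$, and let this orbit be enumerated by $P_1,\ldots,P_m$. Then for any functions $f_1,\ldots,f_m\in L^+(X)$, $$\left\|\prod_{i=1}^m f_i^{1/m}\right\|_{L^{\overline p}(X)}\le\prod_{i=1}^m\left\|f_i\right\|_{P_i}^{1/m},$$ where $\overline p=\left(\frac1n\sum_{j=1}^n p_j^{-1}\right)^{-1}$ is the harmonic mean of the exponents.
   Context: $L^+(X)$ denotes the cone of nonnegative measurable functions on $X=X_1\times\cdots\times X_n$; $x_j$ denotes the variable ranging over $X_j$. Mixed norms: for exponents $r_1,\ldots,r_n\in(0,\infty]$ and the double $n$-tuple $R=\left(\begin{array}{ccc}r_1&\cdots&r_n\\ x_1&\cdots&x_n\end{array}\right)$, the mixed norm of a measurable $f$ on $X$ is $$\|f\|_R=\left(\int_{X_n}\cdots\left(\int_{X_1}|f(x_1,\ldots,x_n)|^{r_1}\,d\mu_1(x_1)\right)^{r_2/r_1}\cdots\,d\mu_n(x_n)\right)^{1/r_n},$$ i.e. one takes successively the $L^{r_1}$ (quasi-)norm in $x_1$, then the $L^{r_2}$ (quasi-)norm in $x_2$ of the result, and so on; if some $r_j=\infty$, the corresponding step is the essential supremum in that variable. Exponents smaller than $1$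 are allowed (so $\|\cdot\|_R$ need not be an actual norm), and the value may be $+\infty$. Similarly $\|\cdot\|_{L^p(X)}$ for $p\in(0,\infty]$ is the usual (quasi-)norm. For $\sigma\in S_n$, $P^\sigma=\left(\begin{array}{ccc}p_{\sigma(1)}&\cdots&p_{\sigma(n)}\\ x_1&\cdots&x_n\end{array}\right)$ (the exponents are permuted, the order of the variables is kept fixed). The orbit is the set of distinct double $n$-tuples so obtained. In the harmonic mean, $1/\infty=0$ and $1/0=\infty$. *)

(* Defs.v *)
From HB Require Import structures.
From mathcomp Require Import all_boot all_order all_algebra all_fingroup.
From mathcomp Require Import all_classical all_reals all_analysis.
From mathcomp Require Import measurable_realfun.

Set Implicit Arguments.
Unset Strict Implicit.
Unset Printing Implicit Defensive.

Import Order.TTheory GRing.Theory Num.Theory.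
Local Open Scope classical_set_scope.
Local Open Scope ring_scope.
Local Open Scope ereal_scope.

Record sfspace (R : realType) := SFSpace {
  sf_display : measure_display;
  sf_sort :> measurableType sf_display;
  sf_measure : {sigma_finite_measure set sf_sort -> \bar R} }.

Lemma product_measure_sigma_finite (R : realType) (X Y : sfspace R) :
  sigma_finite [set: X * Y] (sf_measure X \x sf_measure Y).
Proof.
have /sigma_finiteP[F [TF ndF Foo]] := sigma_finiteT (sf_measure X).
have /sigma_finiteP[G [TG ndG Goo]] := sigma_finiteT (sf_measure Y).
exists (fun n => F n `*` G n).
  rewrite -setXTT TF TG predeqE => -[x y]; split.
    move=> [/= [n _ Fnx] [k _ Gky]]; exists (maxn n k) => //; split.
    - by move: x Fnx; exact/subsetPset/ndF/leq_maxl.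
    - by move: y Gky; exact/subsetPset/ndG/leq_maxr.
  by move=> [n _ []/= ? ?]; split; exists n.
move=> k; have [? ?] := Foo k; have [? ?] := Goo k.
split; first exact: measurableX.
by rewrite product_measure1E// lte_mul_pinfty// ge0_fin_numE.
Qed.

(* The sigma-finiteness instance of [\x] is declared by the library but is
   shadowed there by the one for sub-probabilities, hence the explicit
   packing. *)
Definition prod_sfspace (R : realType) (X Y : sfspace R) : sfspace R :=
  let mu : set (X * Y) -> \bar R := sf_measure X \x sf_measure Y in
  @SFSpace R _ (X * Y)%type
    (HB.pack_for {sigma_finite_measure set (X * Y)%type -> \bar R} mu
      (Measure.on mu)
      (Measure_isSigmaFinite.Build _ _ _ mu
        (product_measure_sigma_finite X Y))).

(* [big_prod_sfspace X] is X_1 * (X_2 * (... * X_n)), the product of the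
   nonempty finite family [X] of sigma-finite measure spaces. *)
Fixpoint big_prod_sfspace (R : realType) (n : nat) :
    ('I_n.+1 -> sfspace R) -> sfspace R :=
  match n with
  | 0 => fun X => X ord0
  | n'.+1 => fun X =>
      prod_sfspace (X ord0) (big_prod_sfspace (fun i => X (lift ord0 i)))
  end.

(* The norm in the first variable is the innermost one. *)
Fixpoint mixed_norm (R : realType) (n : nat) :
    forall (X : 'I_n.+1 -> sfspace R) (r : 'I_n.+1 -> \bar R),
      (big_prod_sfspace X -> \bar R) -> \bar R :=
  match n with
  | 0 => fun X r f => Lnorm (sf_measure (X ord0)) (r ord0) f
  | n'.+1 => fun X r f =>
      @mixed_norm R n' (fun i => X (lift ord0 i)) (fun i => r (lift ord0 i))
        (fun y => Lnorm (sf_measure (X ord0)) (r ord0) (fun x => f (x, y)))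
  end.

(* The row of variables of a double tuple is fixed, so that a double tuple is
   encoded by its row of exponents. *)
Definition permute_exponents (R : realType) (n : nat) (p : 'I_n -> \bar R)
    (s : 'S_n) : 'I_n -> \bar R := fun j => p (s j).

Definition exponent_orbit (R : realType) (n : nat) (p : 'I_n -> \bar R) :
    set ('I_n -> \bar R) := range (permute_exponents p).

(* The inverse is that of the extended reals: 0^-1 = +oo and +oo^-1 = 0. *)
Definition hmean (R : realType) (n : nat) (p : 'I_n -> \bar R) :
    \bar R := ((n%:R^-1)%R%:E * \sum_(j < n) (p j)^-1)^-1.

(* Main.v *)
Require Import Defs.
From mathcomp Require Import all_boot all_order all_algebra all_fingroup.
From mathcomp Require Import all_classical all_reals all_analysis.
From mathcomp Require Import measurable_realfun ess_sup_inf.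

(** Average the exponent rows of the orbit harmonically, column by column.
    Since the orbit is stable under permutations, all columns have the same
    harmonic mean, and this common value is that of [p]. The Hoelder inequality
    for [m] functions, applied one variable at a time, then bounds the mixed
    norm with the constant exponent [hmean p] of the geometric mean of the
    [f i], and by Tonelli a mixed norm with constant exponent dominates the
    Lebesgue norm on the product. *)

Set Implicit Arguments.
Unset Strict Implicit.
Unset Printing Implicit Defensive.

Import Order.TTheory GRing.Theory Num.Theory.

Local Open Scope classical_set_scope.
Local Open Scope ring_scope.
Local Open Scope ereal_scope.

(** * Weighted arithmetic-geometric means and powers of extended reals *)

Lemma powR_sumr (R : realType) (I : Type) (s : seq I) (w : I -> R) (x : R) :
  (0 < x)%R -> (\prod_(i <- s) x `^ w i = x `^ (\sum_(i <- s) w i))%R.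
Proof.
move=> x0; elim: s => [|i s IH]; first by rewrite !big_nil powRr0.
by rewrite !big_cons IH powRD// (gt_eqF x0) implybT.
Qed.

(** Since the weights sum to 1, dividing every [a i] by the mean [A] divides the product by [A]. The
    normalised product is at most 1 by [1 + t <= expR t] at [t = a i / A - 1]: the weighted sum of
    these [t] is 0. *)
Lemma weighted_AMGM (R : realType) (I : finType) (w a : I -> R) :
  (forall i, 0 <= w i)%R -> (forall i, 0 <= a i)%R -> (\sum_i w i = 1)%R ->
  (\prod_i a i `^ w i <= \sum_i w i * a i)%R.
Proof.
move=> w0 a0 w1; set A := (\sum_i w i * a i)%R.
have wa0 i : (0 <= w i * a i)%R by rewrite mulr_ge0.
have A0 : (0 <= A)%R by apply: sumr_ge0 => i _; exact: wa0.
(* Division by [A] is impossible when [A = 0]; then some weight is nonzero, its [a i] is 0, and the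
   product vanishes. *)
have [Aeq0|A_neq0] := eqVneq A 0%R.
  have /existsP[i wi] : [exists i, w i != 0%R].
    rewrite -[[exists _, _]]negbK negb_exists; apply/negP => /forallP w_eq0.
    move: (oner_neq0 R); rewrite -w1 big1 ?eqxx// => i _.
    by apply/eqP; rewrite -[_ == _]negbK w_eq0.
  have /eqP : (w i * a i = 0)%R by exact: (psumr_eq0P (fun j _ => wa0 j) Aeq0).
  rewrite mulf_eq0 (negbTE wi) => /= /eqP ai.
  by rewrite (bigD1 i)//= ai powR0// mul0r.
have Agt0 : (0 < A)%R by rewrite lt_neqAle eq_sym A_neq0.
have AE : (\prod_i A `^ w i = A)%R.
  by rewrite powR_sumr// w1 powRr1.
have -> : (\prod_i a i `^ w i = A * \prod_i (a i / A) `^ w i)%R.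
  rewrite -[X in (X * _)%R]AE -big_split/=; apply: eq_bigr => i _.
  by rewrite -powRM ?divr_ge0// mulrC divfK.
rewrite ler_piMr//.
apply: (@le_trans _ _ (\prod_i expR (w i * (a i / A - 1)))%R).
  apply: ler_prod => i _; rewrite powR_ge0/= [(w i * _)%R]mulrC expRM.
  rewrite ge0_ler_powR ?nnegrE ?divr_ge0 ?expR_ge0//.
  by rewrite (le_trans _ (expR_ge1Dx _))// addrC subrK.
rewrite -expR_sum.
under eq_bigr do rewrite mulrBr mulr1 mulrA.
by rewrite sumrB -mulr_suml w1 mulfV// subrr expR0.
Qed.

Lemma le_poweR (R : realType) (r : R) (x y : \bar R) :
  (0 <= r)%R -> 0 <= x -> x <= y -> x `^ r <= y `^ r.
Proof.
move=> r0 x0 xy; apply: gt0_ler_poweR => //; rewrite in_itv/= leey andbT//.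
exact: le_trans xy.
Qed.

Lemma lee_prod (R : realType) (I : Type) (s : seq I) (F G : I -> \bar R) :
  (forall i, 0 <= F i) -> (forall i, F i <= G i) ->
  \prod_(i <- s) F i <= \prod_(i <- s) G i.
Proof.
move=> F0 FG; elim: s => [|i s IH]; first by rewrite !big_nil.
by rewrite !big_cons lee_pmul// prode_ge0.
Qed.

Lemma poweR_prode (R : realType) (I : Type) (s : seq I) (F : I -> \bar R)
    (r : R) : (forall i, 0 <= F i) ->
  (\prod_(i <- s) F i) `^ r = \prod_(i <- s) F i `^ r.
Proof.
move=> F0; elim: s => [|i s IH]; first by rewrite !big_nil poweR1r.
by rewrite !big_cons poweRM ?prode_ge0// IH.
Qed.

Lemma emeasurable_prod d (T : measurableType d) (R : realType) (D : set T)
    (I : Type) (s : seq I) (h : I -> T -> \bar R) :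
  (forall i, measurable_fun D (h i)) ->
  measurable_fun D (fun x => \prod_(i <- s) h i x).
Proof.
move=> mh; elim: s => [|i s IH].
  by under eq_fun do rewrite big_nil; exact: measurable_cst.
by under eq_fun do rewrite big_cons; exact: emeasurable_funM.
Qed.

Lemma measurable_fun_poweR d (T : measurableType d) (R : realType) (D : set T)
    (f : T -> \bar R) (r : R) :
  measurable_fun D f -> measurable_fun D (fun x => f x `^ r).
Proof. exact: (measurableT_comp (@measurable_poweR R r)). Qed.

(** Reduces to the real case: an infinite [a i] of nonzero weight makes the right side [+oo], while
    one of weight 0 contributes a factor 1 and a summand 0, whatever real number replaces it. *)
Lemma weighted_AMGMe (R : realType) (I : finType) (w : I -> R)
    (a : I -> \bar R) :
  (forall i, 0 <= w i)%R -> (forall i, 0 <= a i) -> (\sum_i w i = 1)%R ->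
  \prod_i a i `^ w i <= \sum_i (w i)%:E * a i.
Proof.
move=> w0 a0 w1.
have wa0 i : 0 <= (w i)%:E * a i by rewrite mule_ge0 ?lee_fin.
have [/existsP[i /andP[wi /eqP ai]]|] :=
    boolP [exists i, (w i != 0)%R && (a i == +oo)].
  suff -> : \sum_i (w i)%:E * a i = +oo by rewrite leey.
  apply/eqP; rewrite esum_eqy => [|j _].
    apply/existsP; exists i => /=.
    by rewrite ai gt0_muley// lte_fin lt_neqAle eq_sym wi w0.
  by rewrite -ltNye (lt_le_trans _ (wa0 j)).
rewrite negb_exists => /forallP wa_fin.
have waE i : (w i = 0)%R \/ a i = (fine (a i))%:E.
  have := wa_fin i; rewrite negb_and negbK => /orP[/eqP|ai]; [by left|right].
  by rewrite fineK// ge0_fin_numE// ltey.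
have -> : \prod_i a i `^ w i = (\prod_i fine (a i) `^ w i)%:E.
  rewrite -prodEFin; apply: eq_bigr => i _.
  by case: (waE i) => ->; rewrite ?poweRe0 ?powRr0.
have -> : \sum_i (w i)%:E * a i = (\sum_i w i * fine (a i))%:E.
  rewrite -sumEFin; apply: eq_bigr => i _.
  by case: (waE i) => ->; rewrite ?mul0e ?mul0r.
by rewrite lee_fin weighted_AMGM// => i; rewrite fine_ge0.
Qed.

(** * Lebesgue norms in one variable and the Hoelder inequality *)

Lemma ae_le_Lnorm d (T : measurableType d) (R : realType)
    (mu : {measure set T -> \bar R}) (p : \bar R) (f g : T -> \bar R) :
  0 < p -> (forall x, 0 <= f x) -> (forall x, 0 <= g x) ->
  measurable_fun [set: T] f -> measurable_fun [set: T] g ->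
  (\forall x \ae mu, f x <= g x) -> Lnorm mu p f <= Lnorm mu p g.
Proof.
move=> p0 f0 g0 mf mg fg.
have absE (h : T -> \bar R) : (forall x, 0 <= h x) -> abse \o h = h.
  by move=> h0; apply/funext => x /=; rewrite gee0_abs.
rewrite -(Lnorm_abse mu f) -(Lnorm_abse mu g) !absE// unlock.
case: p p0 => [p|_|//]; rewrite ?absE//; last first.
  by case: ifPn => // _; exact: le_ess_sup.
rewrite lte_fin => p0.
apply: le_poweR; first by rewrite invr_ge0 ltW.
  by apply: integral_ge0 => x _; exact: poweR_ge0.
apply: ae_ge0_le_integral => //=.
- by move=> x _; exact: poweR_ge0.
- by apply/measurable_fun_poweR/measurableT_comp.
- by move=> x _; exact: poweR_ge0.
- by apply/measurable_fun_poweR/measurableT_comp.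
- apply: filterS fg => x fgx _.
  by rewrite !gee0_abs// le_poweR// ltW.
Qed.

(** At [q = +oo] both sides are 0, because [fine +oo = 0] and the real inverse of 0 is 0.
    Reciprocals of exponents can thus be summed in [R]. *)
Lemma inve_fine (R : realType) (q : \bar R) :
  0 < q -> q^-1 = ((fine q)^-1)%:E.
Proof.
case: q => [q||//] q0; last by rewrite invey /= invr0.
by rewrite inver gt_eqF.
Qed.

Lemma prode_gt0 (R : realType) (I : Type) (s : seq I) (P : pred I)
    (F : I -> \bar R) :
  (forall i, 0 < F i) -> 0 < \prod_(i <- s | P i) F i.
Proof. by move=> F0; elim/big_ind : _ => // x y; exact: mule_gt0. Qed.

Lemma Lnorm_pinfty_ae d (T : measurableType d) (R : realType)
    (mu : {measure set T -> \bar R}) (f : T -> \bar R) :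
  (forall x, 0 <= f x) -> \forall x \ae mu, f x <= Lnorm mu +oo f.
Proof.
move=> f0; rewrite unlock /Lnorm; case: ifPn => muT.
  have := ess_sup_ge mu (abse \o f).
  by apply: filterS => x /=; rewrite gee0_abs.
(* On a null space the norm takes its default value 0, but there [f] equals 0 almost everywhere. *)
have /ae_eq0 muae : mu [set: T] = 0.
  by apply/eqP; rewrite eq_le measure_ge0 andbT leNgt.
have := muae _ f (cst 0) measurableT.
by apply: filterS => x /= ->.
Qed.

(** For finite [r], normalise each [f i] by its norm, apply weighted AM-GM pointwise to the powers
    [(f i / M i) ^ q i] with weights [r * c i / q i], which sum to 1, and integrate. No triangle
    inequality enters, so exponents below 1 are allowed. *)
Lemma Lnorm_prode d (T : measurableType d) (R : realType)
    (mu : {measure set T -> \bar R}) (I : finType) (c : I -> R)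
    (q : I -> \bar R) (r : \bar R) (f : I -> T -> \bar R) :
  (forall i, 0 < c i)%R -> (forall i, 0 < q i) -> 0 < r ->
  r^-1 = \sum_i (c i)%:E * (q i)^-1 ->
  (forall i x, 0 <= f i x) -> (forall i, measurable_fun [set: T] (f i)) ->
  Lnorm mu r (fun x => \prod_i f i x `^ c i)
    <= \prod_i Lnorm mu (q i) (f i) `^ c i.
Proof.
move=> c0 q0 r0 rE f0 mf; set N := fun i => Lnorm mu (q i) (f i).
pose F x := \prod_i f i x `^ c i; rewrite -/F.
have F0 x : 0 <= F x by apply: prode_ge0 => i _; exact: poweR_ge0.
have mF : measurable_fun [set: T] F.
  by apply: emeasurable_prod => i; exact: measurable_fun_poweR.
have N0 i : 0 <= N i by exact: Lnorm_ge0.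
(* A zero norm forces [f i], hence the product, to vanish almost everywhere. *)
have [/existsP[i /eqP Ni]|] := boolP [exists i, N i == 0].
  apply: (@le_trans _ _ 0).
    rewrite -[leRHS](@Lnorm0 _ _ _ mu r) ?gt_eqF//.
    apply: ae_le_Lnorm => //.
    have := Lnorm_eq0_eq0 (mf i) (q0 i) Ni; apply: filterS => x /(_ Logic.I) fx.
    have {}fx : f i x = 0 := fx.
    by rewrite /F (bigD1 i)//= fx poweR0r ?gt_eqF// mul0e.
  by apply: prode_ge0 => j _; exact: poweR_ge0.
rewrite negb_exists => /forallP N_neq0.
have Ngt0 i : 0 < N i by rewrite lt0e N_neq0 N0.
(* All norms are now positive, so an infinite one makes the whole right side infinite. *)
have [/existsP[i /eqP Ni]|] := boolP [exists i, N i == +oo].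
  suff -> : \prod_i N i `^ c i = +oo by rewrite leey.
  rewrite (bigD1 i)// Ni poweRyr ?gt_eqF//= gt0_mulye// prode_gt0// => j.
  exact: poweR_gt0.
rewrite negb_exists => /forallP N_fin.
have NE i : N i = (fine (N i))%:E.
  by rewrite fineK// ge0_fin_numE// ltey N_fin.
pose M i := fine (N i).
have M0 i : (0 < M i)%R by rewrite -lte_fin -NE.
have fN : \forall x \ae mu, forall i, q i = +oo -> f i x <= N i.
  apply: filter_forall => i; have [qi|qi] := eqVneq (q i) +oo.
    have := Lnorm_pinfty_ae mu (f0 i).
    by apply: filterS => x; rewrite /N qi.
  by apply: nearW => x /eqP; rewrite (negbTE qi).
have prodN : \prod_i N i `^ c i = (\prod_i M i `^ c i)%:E.
  by rewrite -prodEFin; apply: eq_bigr => i _; rewrite NE.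
rewrite prodN; set K := (\prod_i M i `^ c i)%R in prodN *.
have sumE : r^-1 = (\sum_i c i * (fine (q i))^-1)%:E.
  by rewrite rE -sumEFin; apply: eq_bigr => i _; rewrite inve_fine.
case: r r0 rE sumE => [r|_|//].
- rewrite lte_fin => r0 _; rewrite inver gt_eqF// => -[rE].
  (* When [q i = +oo], [fine (q i) = 0]: then [w i = 0] and [g i] is constantly
     [1], so that weighted AM-GM ignores the infinite exponents. *)
  pose w i := (r * (c i * (fine (q i))^-1))%R.
  have fq0 i : (0 <= fine (q i))%R by rewrite fine_ge0// ltW.
  have w0 i : (0 <= w i)%R by rewrite !mulr_ge0 ?invr_ge0// ltW.
  have w1 : (\sum_i w i = 1)%R by rewrite -mulr_sumr -rE mulfV ?gt_eqF.
  pose g i x := (f i x * (M i)^-1%:E) `^ fine (q i).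
  have g0 i x : 0 <= g i x by exact: poweR_ge0.
  have mg i : measurable_fun [set: T] (g i).
    by apply: measurable_fun_poweR; exact: emeasurable_funM.
  have Kr0 : 0 <= K%:E `^ r by exact: poweR_ge0.
  suff FK : \int[mu]_x `|F x| `^ r <= K%:E `^ r.
    rewrite unlock.
    rewrite -[leRHS]poweRe1; last first.
      by rewrite -prodN prode_ge0// => i _; exact: poweR_ge0.
    rewrite -(mulfV (lt0r_neq0 r0)) poweRrM.
    apply: le_poweR => //; first by rewrite invr_ge0 ltW.
    by apply: integral_ge0 => x _; exact: poweR_ge0.
  (* The factor [w i] covers [q i = +oo], where it is 0 and the integral of [g i = 1] is the total
     mass, not 1 in general. *)
  have intg i : (w i)%:E * \int[mu]_x g i x = (w i)%:E.
    case qE : (q i) (q0 i) => [qi||//] qi0; last first.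
      by rewrite /w qE /= invr0 !mulr0 mul0e.
    rewrite lte_fin in qi0.
    rewrite [X in _ * X](_ : _ = 1) ?mule1//.
    have MV0 : 0 <= (M i)^-1%:E by rewrite lee_fin invr_ge0 ltW.
    under eq_integral do rewrite /g qE/= poweRM// muleC.
    rewrite ge0_integralZl//; last 3 first.
    + exact: measurable_fun_poweR.
    + by move=> x _; exact: poweR_ge0.
    + exact: poweR_ge0.
    under eq_integral do rewrite -[f i _]gee0_abs//.
    rewrite -poweR_Lnorm ?gt_eqF// -qE -/(N i) NE -poweRM//.
    + by rewrite -EFinM mulVf ?gt_eqF// poweR1r.
    + by rewrite lee_fin; exact: ltW (M0 i).
  have mwg i : measurable_fun [set: T] (fun x => (w i)%:E * g i x).
    exact: measurable_funeM.
  have wg0 i x : 0 <= (w i)%:E * g i x by rewrite mule_ge0 ?lee_fin.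
  have int1 : \int[mu]_x (\sum_i (w i)%:E * g i x) = 1.
    rewrite ge0_integral_sum// -[RHS]/((1%R)%:E) -w1 -sumEFin.
    by apply: eq_bigr => i _; rewrite -[RHS]intg ge0_integralZl// lee_fin.
  (* The bound becomes the integral of [K ^ r] times the weighted mean of the [g i], so comparing
     integrands almost everywhere suffices. *)
  rewrite -[leRHS]mule1 -int1 -ge0_integralZl//; last 2 first.
    exact: emeasurable_sum.
    by move=> x _; exact: sume_ge0.
  apply: ae_ge0_le_integral => //=.
  + by move=> x _; exact: poweR_ge0.
  + by apply/measurable_fun_poweR/measurableT_comp.
  + by move=> x _; rewrite mule_ge0// sume_ge0.
  + by apply: measurable_funeM; exact: emeasurable_sum.
  apply: filterS fN => x fNx _.
  apply: (@le_trans _ _ (K%:E `^ r * \prod_i g i x `^ w i)); last first.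
    by rewrite lee_wpmul2l// weighted_AMGMe.
  rewrite gee0_abs// poweR_prode => [|i]; last exact: poweR_ge0.
  rewrite -prodN poweR_prode => [|i]; last exact: poweR_ge0.
  rewrite -big_split/=; apply: lee_prod => i; first exact: poweR_ge0.
  rewrite -2!(poweRrM _ (c i)) -poweRrM.
  (* For [q i = +oo] the factor from [g i] is 1 and the almost everywhere bound [f i x <= N i] is
     used; for finite [q i] both sides agree, as [q i * w i = c i * r]. *)
  case qE : (q i) (q0 i) => [qi||//] qi0; last first.
    rewrite /= mul0r poweRe0 mule1 le_poweR// ?fNx//.
    by rewrite mulr_ge0// ltW.
  rewrite lte_fin in qi0.
  rewrite /w qE /= [(_ * (r * _))%R](_ : _ = c i * r)%R; last first.
    by rewrite mulrCA [(qi * _)%R]mulrC -mulrA mulVf ?gt_eqF// mulr1 mulrC.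
  rewrite -poweRM//; last by rewrite mule_ge0// lee_fin invr_ge0 ltW.
  by rewrite NE muleCA -EFinM mulfV ?mule1 ?lexx// gt_eqF//; exact: M0.
(* For [r = +oo] a sum of nonnegative reals is 0, which forces every [q i] to be [+oo]; the almost
   everywhere bounds are then multiplied. *)
- move=> _; rewrite invey => -[] /esym /psumr_eq0P sum0.
  have qy i : q i = +oo.
    have /eqP : (c i * (fine (q i))^-1 = 0)%R.
      apply: sum0 => // j _.
      by rewrite mulr_ge0 ?invr_ge0 ?fine_ge0// ltW.
    rewrite mulf_eq0 gt_eqF//= invr_eq0.
    case: (q i) (q0 i) => [qi||]//=.
    by rewrite lte_fin => qi0; rewrite gt_eqF.
  rewrite unlock; case: ifPn => muT; last first.
    by rewrite -prodN prode_ge0// => i _; exact: poweR_ge0.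
  apply/ess_supP; apply: filterS fN => x fNx /=.
  rewrite gee0_abs// -prodN; apply: lee_prod => i; first exact: poweR_ge0.
  by rewrite le_poweR ?fNx// ltW.
Qed.

(** * Partial norms on a product of two spaces *)

Lemma Lnorm_EFinE d (T : measurableType d) (R : realType)
    (mu : {measure set T -> \bar R}) (p : R) (f : T -> \bar R) :
  Lnorm mu p%:E f = (\int[mu]_x `|f x| `^ p) `^ p^-1.
Proof. by rewrite unlock. Qed.

(** Tonelli handles finite exponents. For the essential supremum, the level sets above [a] are the
    [y] at which the section of [A], the set where [|f| > a], has positive measure; section measures
    are measurable in [y]. *)
Lemma measurable_fun_Lnorm_pair1 d1 d2 (T1 : measurableType d1)
    (T2 : measurableType d2) (R : realType)
    (mu : {sigma_finite_measure set T1 -> \bar R}) (p : \bar R)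
    (f : T1 * T2 -> \bar R) :
  0 < p -> measurable_fun [set: T1 * T2] f ->
  measurable_fun [set: T2] (fun y => Lnorm mu p (fun x => f (x, y))).
Proof.
move=> p0 mf.
have mabsf : measurable_fun [set: T1 * T2] (abse \o f).
  exact: measurableT_comp.
rewrite unlock; case: p p0 => [p _|_|//].
  apply: measurable_fun_poweR.
  apply: (@measurable_fun_fubini_tonelli_G _ _ _ _ _ mu
    (fun z => `|f z| `^ p)) => [|z]; last exact: poweR_ge0.
  exact: measurable_fun_poweR.
case: (0 < mu [set: T1]); last exact: measurable_cst.
move=> _; apply: (measurability _ (ErealGenOInfty.measurableE R)) => //.
move=> _ [_ [a ->] <-].
pose A := (abse \o f) @^-1` `]a%:E, +oo[.
have mA : measurable A.
  by rewrite -[A]setTI; apply: mabsf => //; exact: emeasurable_itv.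
rewrite [X in measurable X](_ : _ =
    [set: T2] `&` (mu \o ysection A) @^-1` `]0, +oo]); last first.
  rewrite !setTI; apply/seteqP.
  suff eqv y : (a%:E < ess_sup mu (abse \o (fun x => f (x, y)))) =
      (0 < mu (ysection A y)).
    by split=> y /=; rewrite !in_itv/= ?andbT ?leey ?andbT eqv.
  rewrite ltNge lt0e measure_ge0 andbT; congr (~~ _).
  have mfy : measurable_fun [set: T1] (abse \o (fun x => f (x, y))).
    exact: (measurable_fun_pair1 y mabsf).
  have := ae_le_measureP mu a%:E mfy.
  rewrite -[_ @^-1` _]/((fun x => (x, y)) @^-1` A) -ysectionE => ae_eqv.
  by apply/idP/eqP => [/ess_supP/ae_eqv|/ae_eqv/ess_supP].
by apply: measurable_fun_ysection => //; exact: emeasurable_itv.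
Qed.

(** The bound [0 <= y] serves on a null space, where the norm is 0 by default. *)
Lemma Lnorm_pinfty_le d (T : measurableType d) (R : realType)
    (mu : {measure set T -> \bar R}) (f : T -> \bar R) (y : \bar R) :
  (forall x, 0 <= f x) -> 0 <= y -> (\forall x \ae mu, f x <= y) ->
  Lnorm mu +oo f <= y.
Proof.
move=> f0 y0 fy; rewrite unlock /Lnorm; case: ifPn => // _.
by apply/ess_supP; apply: filterS fy => x; rewrite /= gee0_abs.
Qed.

(** For finite [p] the inner root and the outer power cancel and Tonelli applies. For [p = +oo], the
    set where [f] exceeds the iterated norm [S] is null because almost all its sections are. *)
Lemma Lnorm_prod_le d1 d2 (T1 : measurableType d1) (T2 : measurableType d2)
    (R : realType) (m1 : {sigma_finite_measure set T1 -> \bar R})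
    (m2 : {sigma_finite_measure set T2 -> \bar R}) (p : \bar R)
    (f : T1 * T2 -> \bar R) :
  0 < p -> (forall z, 0 <= f z) -> measurable_fun [set: T1 * T2] f ->
  Lnorm (m1 \x m2) p f <= Lnorm m2 p (fun y => Lnorm m1 p (fun x => f (x, y))).
Proof.
case: p => [p p0|_|//] f0 mf.
  rewrite lte_fin in p0.
  rewrite !(Lnorm_EFinE (m1 \x m2), Lnorm_EFinE m2).
  under [in leRHS]eq_integral => y _.
    rewrite gee0_abs ?Lnorm_ge0// poweR_Lnorm ?gt_eqF//; over.
  rewrite fubini_tonelli2//= => [|z]; last exact: poweR_ge0.
  by apply/measurable_fun_poweR; exact: measurableT_comp.
apply: Lnorm_pinfty_le => //; first exact: Lnorm_ge0.
set S := Lnorm m2 _ _.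
apply/(ae_le_measureP _ _ mf).
set A := f @^-1` _.
have mA : measurable A.
  by rewrite -[A]setTI; apply: mf => //; exact: emeasurable_itv.
rewrite -[A]setIT -integral_indic// fubini_tonelli2//=; last first.
  by apply/measurable_EFinP; exact: measurable_indic.
rewrite indic_fubini_tonelli_GE//.
transitivity (\int[m2]_y (cst 0 y : \bar R)); last by rewrite integral0.
apply: ge0_ae_eq_integral => //=.
- exact: measurable_fun_ysection.
(* For almost every [y] the inner norm is at most [S], and it bounds [f (x, y)] for almost every
   [x]. *)
have := Lnorm_pinfty_ae m2
  (fun y => Lnorm_ge0 m1 +oo (fun x => f (x, y))).
rewrite -/S; apply: filterS => y NyS _ /=.
rewrite ysectionE; apply/(ae_le_measureP m1 S (measurable_fun_pair1 y mf)).
have := Lnorm_pinfty_ae m1 (fun x => f0 (x, y)).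
by apply: filterS => x fxy; exact: le_trans NyS.
Qed.

(** * Mixed norms, by induction on the number of variables *)

Lemma le_mixed_norm (R : realType) (n : nat) (X : 'I_n.+1 -> sfspace R)
    (r : 'I_n.+1 -> \bar R) (f g : big_prod_sfspace X -> \bar R) :
  (forall j, 0 < r j) -> (forall x, 0 <= f x) ->
  measurable_fun [set: big_prod_sfspace X] f ->
  measurable_fun [set: big_prod_sfspace X] g ->
  (forall x, f x <= g x) -> mixed_norm r f <= mixed_norm r g.
Proof.
elim: n X r f g => [|n IH] X r f g r0 f0 mf mg fg /=.
  apply: ae_le_Lnorm => // [x|]; last exact: nearW.
  exact: le_trans (fg x).
apply: IH => [j|y|||y]; rewrite ?Lnorm_ge0//.
- exact: measurable_fun_Lnorm_pair1.
- exact: measurable_fun_Lnorm_pair1.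
apply: ae_le_Lnorm => //.
- by move=> x; exact: le_trans (fg _).
- exact: measurable_fun_pair1.
- exact: measurable_fun_pair1.
- exact: nearW.
Qed.

(** Hoelder in the innermost variable bounds the inner norm pointwise; monotonicity and the
    induction hypothesis for the inner norms of the [f i] do the rest. The rows [q i] are arbitrary
    because dropping a column does not preserve the structure of an orbit. *)
Lemma mixed_norm_prode (R : realType) (n : nat) (X : 'I_n.+1 -> sfspace R)
    (J : finType) (c : J -> R) (q : J -> 'I_n.+1 -> \bar R)
    (r : 'I_n.+1 -> \bar R) (f : J -> big_prod_sfspace X -> \bar R) :
  (forall i, 0 < c i)%R -> (forall i j, 0 < q i j) -> (forall j, 0 < r j) ->
  (forall j, (r j)^-1 = \sum_i (c i)%:E * (q i j)^-1) ->
  (forall i x, 0 <= f i x) ->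
  (forall i, measurable_fun [set: big_prod_sfspace X] (f i)) ->
  mixed_norm r (fun x => \prod_i f i x `^ c i)
    <= \prod_i mixed_norm (q i) (f i) `^ c i.
Proof.
move=> c0; elim: n X q r f => [|n IH] X q r f q0 r0 rE f0 mf /=.
  exact: Lnorm_prode.
have mfN i : measurable_fun [set: big_prod_sfspace (fun i => X (lift ord0 i))]
    (fun y => Lnorm (sf_measure (X ord0)) (q i ord0) (fun x => f i (x, y))).
  exact: (measurable_fun_Lnorm_pair1 _ (q0 i ord0) (mf i)).
have mF : measurable_fun [set: big_prod_sfspace X]
    (fun x => \prod_i f i x `^ c i).
  by apply: emeasurable_prod => i; exact: measurable_fun_poweR.
apply: le_trans (IH _ (fun i j => q i (lift ord0 j)) _ _ _ _ _ _ mfN).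
- apply: le_mixed_norm => [j|y|||y]; first exact: r0.
  + exact: Lnorm_ge0.
  + exact: (measurable_fun_Lnorm_pair1 _ (r0 ord0) mF).
  + by apply: emeasurable_prod => i; exact: measurable_fun_poweR.
  + by apply: Lnorm_prode => // i; exact: measurable_fun_pair1.
- by move=> i j; exact: q0.
- by move=> j; exact: r0.
- by move=> j; exact: rE.
- by move=> i y; exact: Lnorm_ge0.
Qed.

Lemma Lnorm_le_mixed_norm (R : realType) (n : nat) (X : 'I_n.+1 -> sfspace R)
    (p : \bar R) (f : big_prod_sfspace X -> \bar R) :
  0 < p -> (forall x, 0 <= f x) ->
  measurable_fun [set: big_prod_sfspace X] f ->
  Lnorm (sf_measure (big_prod_sfspace X)) p f <= mixed_norm (fun=> p) f.
Proof.
move=> p0; elim: n X f => [//|n IH] X f f0 mf /=.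
apply: le_trans (IH _ _ _ _); last 2 first.
- by move=> y; exact: Lnorm_ge0.
- exact: measurable_fun_Lnorm_pair1.
exact: Lnorm_prod_le.
Qed.

(** * Column averages over the orbit, and the final inequality *)

(** Sum the table [h (P i k)] in two ways: all columns have the same sum, as permuting columns only
    permutes the rows of the orbit, and every row is a rearrangement of [p]. *)
Lemma sum_exponent_orbit (V : nmodType) (R : realType) (n m : nat)
    (p : 'I_n -> \bar R) (P : 'I_m -> 'I_n -> \bar R) (h : \bar R -> V)
    (j : 'I_n) :
  set_bij [set: 'I_m] (exponent_orbit p) P ->
  ((\sum_i h (P i j)) *+ n = (\sum_k h (p k)) *+ m)%R.
Proof.
move=> [Porbit Pinj Psurj].
have sumE (s : 'S_n) k : (\sum_i h (P i (s k)) = \sum_i h (P i k))%R.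
  have /choice[t tE] i : exists i', P i' = permute_exponents (P i) s.
    have [u _ uE] := Porbit i Logic.I.
    have [|i' _ i'E] := Psurj (permute_exponents (P i) s); last by exists i'.
    exists (s * u)%g => //.
    by rewrite -uE; apply/funext => l; rewrite /permute_exponents permM.
  (* Permuting columns by [s] is invertible and [P] is injective, so [t] permutes the row
     indices. *)
  have t_inj : injective t.
    move=> i i' tii'; apply: Pinj; rewrite ?inE//; apply/funext => l.
    have /(congr1 (fun q => q (s^-1%g l))) := tE i.
    by rewrite tii' tE /permute_exponents permKV.
  rewrite [RHS](reindex_inj t_inj); apply: eq_bigr => i _.
  by rewrite tE.
(* The transposition of [j] and [k] carries column [k] to column [j]. *)
transitivity (\sum_(k < n) \sum_i h (P i k))%R.
  rewrite -[X in (_ *+ X)%R](card_ord n) -sumr_const; apply: eq_bigr => k _.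
  by rewrite -(sumE (tperm j k) j) tpermL.
rewrite exchange_big/= -[X in (_ *+ X)%R](card_ord m) -sumr_const.
apply: eq_bigr => i _; have [s _ <-] := Porbit i Logic.I.
by rewrite [RHS](reindex_inj (@perm_inj _ s)).
Qed.

Theorem theorem3p5 (R : realType) (n : nat) (X : 'I_n.+1 -> sfspace R)
    (p : 'I_n.+1 -> \bar R) (p_gt0 : forall j, 0 < p j)
    (m : nat) (P : 'I_m -> 'I_n.+1 -> \bar R)
    (P_enum : set_bij [set: 'I_m] (exponent_orbit p) P)
    (f : 'I_m -> big_prod_sfspace X -> \bar R)
    (f_ge0 : forall i x, 0 <= f i x)
    (f_meas : forall i, measurable_fun [set: big_prod_sfspace X] (f i)) :
  Lnorm (sf_measure (big_prod_sfspace X)) (hmean p)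
    (fun x => \prod_(i < m) f i x `^ (m%:R^-1)%R)
  <= \prod_(i < m) mixed_norm (P i) (f i) `^ (m%:R^-1)%R.
Proof.
have P_gt0 i j : 0 < P i j.
  have [Porbit _ _] := P_enum; have [s _ <-] := Porbit i Logic.I.
  exact: p_gt0.
have m_gt0 : (0 < m)%N.
  have [_ _ Psurj] := P_enum.
  have [|i _ _] := Psurj p; last exact: leq_ltn_trans (ltn_ord i).
  by exists 1%g => //; apply/funext => j; rewrite /permute_exponents perm1.
(* The reciprocal of [hmean p], kept real; it may be 0, in which case [hmean p] is [+oo]. *)
pose y : R := (n.+1%:R^-1 * \sum_j (fine (p j))^-1)%R.
have y_ge0 : (0 <= y)%R.
  rewrite mulr_ge0 ?invr_ge0// sumr_ge0// => j _.
  by rewrite invr_ge0 fine_ge0// ltW.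
have hmeanE : hmean p = y%:E^-1.
  congr (_^-1); rewrite EFinM -sumEFin; congr (_ * _).
  by apply: eq_bigr => j _; exact: inve_fine.
have hmean_gt0 : 0 < hmean p.
  rewrite hmeanE inver; case: ifPn => // y_neq0.
  by rewrite lte_fin invr_gt0 lt_neqAle eq_sym y_neq0.
(* This is the Hoelder condition for column [j] with all weights [1 / m]. *)
have hmeanV j : (hmean p)^-1 = \sum_(i < m) (m%:R^-1)%:E * (P i j)^-1.
  rewrite hmeanE inveK.
  under eq_bigr do rewrite inve_fine// -EFinM.
  rewrite sumEFin -mulr_sumr; congr EFin.
  have := sum_exponent_orbit (fun q => (fine q)^-1)%R j P_enum.
  rewrite -[LHS]mulr_natr -[RHS]mulr_natr => sumE.
  apply: (mulIf (_ : n.+1%:R != 0 :> R)%R); first by rewrite pnatr_eq0.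
  rewrite -[RHS]mulrA sumE /y mulrC mulrA mulfV ?pnatr_eq0// mul1r.
  by rewrite mulrCA mulVf ?mulr1// pnatr_eq0 -lt0n.
apply: le_trans (Lnorm_le_mixed_norm hmean_gt0 _ _) _.
- by move=> x; apply: prode_ge0 => i _; exact: poweR_ge0.
- by apply: emeasurable_prod => i; exact: measurable_fun_poweR.
apply: mixed_norm_prode => // i; first by rewrite invr_gt0 ltr0n.
Qed.
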